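(* Let $n=2$, $D(x_0,x_1,x_2;p)=\sum_{k=0}^2\binom{2}{k}p^k(1-p)^{2-k}|p-x_k|$, let $\Omega$ be the set of Borel probability measures on $[0,1]$ and $E(\sigma_0,\sigma_1,\sigma_2;\mu)=\iiiint D(x_0,x_1,x_2;p)\,d\sigma_0(x_0)d\sigma_1(x_1)d\sigma_2(x_2)d\mu(p)$. Let $$p_1=\tfrac13\Big(1+\sqrt[3]{1+3\sqrt{57}}-\tfrac{8}{\sqrt[3]{1+3\sqrt{57}}}\Big)\approx0.3611,$$ the unique real root of $x^3-x^2+3x-1$, and set $p_0=0$, $p_2=1-p_1$, $p_3=1$, $$m_1=m_2=\frac{0.5}{p_1^2+(1-p_1)^2+1}\approx0.325,\qquad m_0=m_3=0.5-m_1\approx0.175,$$ $\mu=\sum_{i=0}^3m_i\delta_{p_i}$, and $$a_0=\frac{2p_1(1-p_1)^2}{p_1^2+(1-p_1)^2+1}\approx0.1916,\qquad a_1=0.5,\qquad a_2=1-a_0.$$ Then the strategy pair $(\delta_{a_0},\delta_{a_1},\delta_{a_2};\mu)$ is a Nash equilibrium, i.e. for all $\sigma_0,\sigma_1,\sigma_2,\nu\in\Omega$, $$E(\delta_{a_0},\delta_{a_1},\delta_{a_2};\nu)\le E(\delta_{a_0},\delta_{a_1},\delta_{a_2};\mu)\le E(\sigma_0,\sigma_1,\sigma_2;\mu),$$ so that $\min_{\sigma}\max_{\nu}E=\max_\nu\min_\sigma E$ is attained at this pair. Moreover, this pair is unique in the following sense: if $\sigma_0,\sigma_1,\sigma_2,\nu\in\Omega$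 satisfy the Nash equilibrium (saddle point) condition above, then $\int x\,d\sigma_i(x)=a_i$ for $i=0,1,2$ and $\nu=\sum_{i=0}^3m_i\delta_{p_i}$.
   Context: $\delta_x$ denotes the unit point mass at $x$. Player II chooses distributions $\sigma_0,\sigma_1,\sigma_2$ (guesses for the coin bias after observing $0,1,2$ heads in two tosses) and Player I chooses a distribution $\nu$ for the bias $p$; Player II pays the expected absolute error $E$. *)

(* Defs.v *)
From mathcomp Require Import all_boot all_order all_algebra.
From mathcomp Require Import all_classical all_reals all_analysis.
Set Implicit Arguments. Unset Strict Implicit. Unset Printing Implicit Defensive.
Import Order.TTheory GRing.Theory Num.Theory.
Local Open Scope classical_set_scope.
Local Open Scope ring_scope.

Section Defs.
Variable R : realType.

Definition I01 : set R := `[(0:R), 1]%classic.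

(* Omega: Borel probability measures on [0,1], i.e. probability measures on
   the Borel sets of R that are concentrated on [0,1]. *)
Definition Omega (mu : probability R R) : Prop := mu I01 = 1%E.

Definition Dpay (x0 x1 x2 p : R) : R :=
  \sum_(k < 3) ('C(2, k))%:R * p ^+ k * (1 - p) ^+ (2 - k)
      * `| p - [:: x0; x1; x2]`_k |.

Definition Epay (s0 s1 s2 mu : set R -> \bar R) : \bar R :=
  (\int[mu]_(p in I01) \int[s2]_(x2 in I01) \int[s1]_(x1 in I01)
     \int[s0]_(x0 in I01) (Dpay x0 x1 x2 p)%:E)%E.

Definition cbrt57 : R := powR (1 + 3 * Num.sqrt 57) (3^-1).

Definition p1 : R := 3^-1 * (1 + cbrt57 - 8 / cbrt57).

Definition pp (i : 'I_4) : R := [:: 0; p1; 1 - p1; 1]`_i.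

Definition m1 : R := (2^-1) / (p1 ^+ 2 + (1 - p1) ^+ 2 + 1).
Definition m0 : R := 2^-1 - m1.
Definition mm (i : 'I_4) : R := [:: m0; m1; m1; m0]`_i.

Definition mustar (A : set R) : \bar R :=
  (\sum_(i < 4) (mm i)%:E * \d_(pp i) A)%E.

Definition a0 : R := 2 * p1 * (1 - p1) ^+ 2 / (p1 ^+ 2 + (1 - p1) ^+ 2 + 1).
Definition a1 : R := 2^-1.
Definition a2 : R := 1 - a0.
Definition aa (i : 'I_3) : R := [:: a0; a1; a2]`_i.

Definition saddle (s0 s1 s2 nu : set R -> \bar R) : Prop :=
  (forall (t0 t1 t2 nu' : probability R R),
      Omega t0 -> Omega t1 -> Omega t2 -> Omega nu' ->
      (Epay s0 s1 s2 nu' <= Epay s0 s1 s2 nu)%E /\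
      (Epay s0 s1 s2 nu <= Epay t0 t1 t2 nu)%E).

End Defs.

(* Main.v *)
(* Averaging over the guesses, the payoff against a bias q is
   F(q) = (1-q)^2 G0(q) + 2q(1-q) G1(q) + q^2 G2(q), where Gk(q) is the mean
   distance from q to the k-th guess.

   For the guesses (a0, a1, a2), F is symmetric about 1/2, equals a0 - 2 a0 q on
   [0, a0] and a0 - 2 (q - p1)^2 (2 + a0 - 2 p1 - q) on [a0, 1/2]: the cubic
   equation of p1 says exactly that the maximum a0 is attained both at 0 and at
   the critical point p1.  Hence F <= a0, with equality only at the atoms of mu.

   Against mu, each guess faces a weighted median problem whose weights are
   balanced, so Jensen's inequality Gk(q) >= |q - mean| bounds the payoff below
   by a0.

   Given another equilibrium (sigma, nu), testing it against point masses yields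
   F_sigma(p_i) <= a0 at the four atoms; the mu-average being at least a0, all
   these are equalities, and so is Jensen's inequality, which gives the means of
   sigma.  Moreover (a0, a1, a2) achieves a0 against nu, so nu lives on the four
   atoms; its weights are then determined because (a0, a1, a2) is an interior
   minimum of a piecewise affine function. *)
Require Import Defs.
From mathcomp Require Import all_boot all_order all_algebra.
From mathcomp Require Import all_classical all_reals all_analysis.
From mathcomp Require Import measurable_realfun ring lra.
Import Order.TTheory GRing.Theory Num.Theory.
Local Open Scope classical_set_scope.
Local Open Scope ring_scope.
Import numFieldNormedType.Exports.

Set Implicit Arguments.
Unset Strict Implicit.
Unset Printing Implicit Defensive.

(** * The cubic equation of [p1] and the constants derived from it *)

Section constants.
Context {R : realType}.

(** Cardano's formula: for [c := cbrt57 R] and [d := 8 / c] one has [c * d = 8] and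
    [c ^+ 3 - d ^+ 3 = 2], the latter because [9 * 57 - 1 = 8 ^+ 3]; these two relations annihilate
    the cubic at [(1 + c - d) / 3]. *)
Lemma p1_root : p1 R ^+ 3 - p1 R ^+ 2 + 3 * p1 R - 1 = 0.
Proof.
set s : R := Num.sqrt 57.
have s2 : s ^+ 2 = 57 by rewrite /s sqr_sqrtr.
have s0 : 0 <= s by rewrite /s sqrtr_ge0.
have s13 : 0 < 1 + 3 * s by lra.
have c0 : 0 < cbrt57 R by rewrite /cbrt57 powR_gt0.
have c3 : cbrt57 R ^+ 3 = 1 + 3 * s.
  by rewrite /cbrt57 -powR_mulrn ?powR_ge0// -powRrM mulVf ?powRr1 //; lra.
rewrite /p1; set c := cbrt57 R in c0 c3 *; set d := 8 / c.
have cd : c * d = 8 by rewrite /d mulrC divfK// gt_eqF.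
have d3 : d ^+ 3 = 3 * s - 1.
  apply: (@mulfI _ (c ^+ 3)); first by rewrite c3 gt_eqF.
  rewrite -exprMn cd c3.
  have -> : (1 + 3 * s) * (3 * s - 1) = 9 * s ^+ 2 - 1 by ring.
  by rewrite s2; ring.
have -> : (3^-1 * (1 + c - d)) ^+ 3 - (3^-1 * (1 + c - d)) ^+ 2 +
    3 * (3^-1 * (1 + c - d)) - 1 =
    27^-1 * (c ^+ 3 - d ^+ 3 - 3 * (c * d) * (c - d) + 24 * (c - d) - 2) by field.
by rewrite c3 d3 cd; field.
Qed.

Lemma p1_root_uniq (x : R) : x ^+ 3 - x ^+ 2 + 3 * x - 1 = 0 -> x = p1 R.
Proof.
have := p1_root; set p := p1 R => hp hx.
have : (x - p) * (x ^+ 2 + x * p + p ^+ 2 - (x + p) + 3) = 0.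
  by rewrite -[RHS](subrr 0) -{1}hx -{1}hp; ring.
move/eqP; rewrite mulf_eq0 => /orP[|/eqP h]; first by rewrite subr_eq0 => /eqP.
(* The cofactor is [(x ^+ 2 + p ^+ 2 + (x + p - 1) ^+ 2 + 5) / 2], hence positive. *)
by have := sqr_ge0 x; have := sqr_ge0 p; have := sqr_ge0 (x + p - 1); lra.
Qed.

Lemma p1_bounds : 1 / 3 < p1 R < 1 / 2.
Proof.
have := p1_root; set p := p1 R => hp.
by apply/andP; split; rewrite ltNge; apply/negP => h; nra.
Qed.

(** A simpler fraction for [a0], owed to the cubic of [p1]: after cross-multiplication the two sides
    differ by [- 2 * p1] times that cubic. *)
Lemma a0_def : a0 R * (1 + p1 R) = 2 * p1 R ^+ 2.
Proof.
have hp := p1_root; have hb := p1_bounds; rewrite /a0.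
move: (p1 R) hp hb => p hp hb.
have S0 : p ^+ 2 + (1 - p) ^+ 2 + 1 != 0 by rewrite gt_eqF//; nra.
rewrite mulrAC; apply: (canLR (mulfK S0)).
apply/eqP; rewrite -subr_eq0; apply/eqP.
have -> : 2 * p * (1 - p) ^+ 2 * (1 + p) - 2 * p ^+ 2 * (p ^+ 2 + (1 - p) ^+ 2 + 1)
  = - (2 * p * (p ^+ 3 - p ^+ 2 + 3 * p - 1)) by ring.
by rewrite hp mulr0 oppr0.
Qed.

Lemma a0_bounds : 0 < a0 R < p1 R.
Proof.
have ha := a0_def; have hb := p1_bounds.
move: (p1 R) (a0 R) hb ha => p a hb ha.
by apply/andP; split; nra.
Qed.

Lemma m1_def : m1 R * (p1 R ^+ 2 + (1 - p1 R) ^+ 2 + 1) = 1 / 2.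
Proof.
have hb := p1_bounds; rewrite /m1 div1r divfK// gt_eqF//.
by move: (p1 R) hb => p hb; nra.
Qed.

Lemma m1_bounds : 0 < m1 R < 1 / 2.
Proof.
have h := m1_def; have hb := p1_bounds.
move: (p1 R) (m1 R) hb h => p a hb h.
by apply/andP; split; nra.
Qed.

(** * The payoff of the pure guesses [a0], [a1], [a2] as a function of the bias *)

Lemma DpayE (x0 x1 x2 q : R) : Dpay x0 x1 x2 q =
  (1 - q) ^+ 2 * `|q - x0| + 2 * q * (1 - q) * `|q - x1| + q ^+ 2 * `|q - x2|.
Proof.
rewrite /Dpay !big_ord_recr big_ord0 /= bin0 bin1 binn.
by ring.
Qed.

(** Exchanging heads and tails swaps the guesses [a0] and [a2 = 1 - a0] and fixes [a1 = 1 / 2]. *)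
Lemma Dpay_refl (q : R) :
  Dpay (a0 R) (a1 R) (a2 R) (1 - q) = Dpay (a0 R) (a1 R) (a2 R) q.
Proof.
rewrite !DpayE /a2 /a1 (_ : 1 - q - a0 R = - (q - (1 - a0 R))); last by ring.
rewrite (_ : 1 - q - 2^-1 = - (q - 2^-1)); last by field.
rewrite (_ : 1 - q - (1 - a0 R) = - (q - a0 R)); last by ring.
by rewrite !normrN; ring.
Qed.

Lemma Dpay_left (q : R) : q <= a0 R ->
  Dpay (a0 R) (a1 R) (a2 R) q = a0 R - 2 * a0 R * q.
Proof.
have := a0_bounds; have := p1_bounds => hp ha hq.
rewrite DpayE /a2 /a1 !ler0_norm; [by field|lra..].
Qed.

Lemma Dpay_middle (q : R) : a0 R <= q <= 1 / 2 ->
  Dpay (a0 R) (a1 R) (a2 R) q =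
    a0 R - 2 * (q - p1 R) ^+ 2 * (2 + a0 R - 2 * p1 R - q).
Proof.
have := a0_bounds; have := p1_bounds => hp ha hq.
have hr := p1_root; have hd := a0_def.
rewrite DpayE /a2 /a1 ger0_norm ?ler0_norm; [|lra..].
move: (a0 R) (p1 R) hp ha hq hr hd => a p hp ha hq hr hd.
have p1n : 1 + p != 0 by rewrite gt_eqF//; lra.
have -> : a = 2 * p ^+ 2 / (1 + p) by rewrite -hd mulfK.
apply/eqP; rewrite -subr_eq0; apply/eqP.
(* With [a] eliminated, the difference of the two sides is a multiple of the cubic of [p1]. *)
transitivity ((2 * q) * (p ^+ 3 - p ^+ 2 + 3 * p - 1) * (-1) / (1 + p)); last first.
  by rewrite hr mulr0 !mul0r.
by field.
Qed.

Lemma Dpay_le (q : R) : 0 <= q <= 1 -> Dpay (a0 R) (a1 R) (a2 R) q <= a0 R.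
Proof.
have ha := a0_bounds; have hp := p1_bounds.
wlog : q / q <= 1 / 2 => [ih hq|hq /andP[q0 _]].
  have [|h] := leP q (1 / 2); first by move/ih; apply.
  by rewrite -Dpay_refl; apply: ih; lra.
have [h|h] := leP q (a0 R); first by
  rewrite Dpay_left//; have := mulr_ge0 (ltW (andP ha).1) q0; lra.
rewrite Dpay_middle; last lra.
have d0 : 0 <= 2 + a0 R - 2 * p1 R - q by lra.
by have := mulr_ge0 (sqr_ge0 (q - p1 R)) d0; lra.
Qed.

Lemma Dpay_eq (q : R) : 0 <= q <= 1 -> Dpay (a0 R) (a1 R) (a2 R) q = a0 R ->
  exists i, q = pp R i.
Proof.
have ha := a0_bounds; have hp := p1_bounds.
have left (r : R) : 0 <= r <= 1 / 2 ->
    Dpay (a0 R) (a1 R) (a2 R) r = a0 R -> r = 0 \/ r = p1 R.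
  move=> hr; have [h|h] := leP r (a0 R).
    by rewrite Dpay_left// => e; left; apply: (@mulfI _ (2 * a0 R));
      [rewrite mulf_neq0 ?gt_eqF//; lra|lra].
  rewrite Dpay_middle; last lra.
  (* The last factor is positive, as [r] and [p1] are at most 1/2, so the square must vanish. *)
  move/eqP; rewrite subr_eq addrC -subr_eq subrr eq_sym mulf_eq0 => /orP[|]; last first.
    by move/eqP => h'; exfalso; lra.
  by rewrite mulf_eq0 pnatr_eq0/= sqrf_eq0 subr_eq0 => /eqP ->; right.
move=> hq; have [h|h] := leP q (1 / 2) => hD.
  have q2 : 0 <= q <= 1 / 2 by lra.
  have [->|->] := left q q2 hD.
  - by exists (@Ordinal 4 0 isT).
  - by exists (@Ordinal 4 1 isT).
rewrite -Dpay_refl in hD.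
have q2 : 0 <= 1 - q <= 1 / 2 by lra.
have [e|e] := left _ q2 hD.
- by exists (@Ordinal 4 3 isT); rewrite /pp/=; lra.
- by exists (@Ordinal 4 2 isT); rewrite /pp/=; lra.
Qed.

Lemma Dpay_pp i : Dpay (a0 R) (a1 R) (a2 R) (pp R i) = a0 R.
Proof.
have ha := a0_bounds; have hp := p1_bounds.
case: i => -[|[|[|[|//]]]] ?; rewrite /pp/=.
- by rewrite Dpay_left; [ring|lra].
- by rewrite Dpay_middle; [ring|lra].
- by rewrite Dpay_refl Dpay_middle; [ring|lra].
- by rewrite -Dpay_refl subrr Dpay_left; [ring|lra].
Qed.

End constants.

(** * Integration over [0,1] and mean distances *)

Section integrals.
Context {R : realType}.

Lemma measurable_I01 : measurable (@I01 R).
Proof. exact: measurable_itv. Qed.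

Lemma I01P (x : R) : I01 x <-> 0 <= x <= 1.
Proof. by rewrite /I01 /= in_itv. Qed.

Lemma continuous_integrable_I01 (s : probability R R) (f : R -> R) :
  continuous f -> s.-integrable (@I01 R) (EFin \o f).
Proof.
move=> cf; apply: measurable_bounded_integrable.
- exact: measurable_I01.
- by rewrite ltey_eq fin_num_measure//; exact: measurable_I01.
- by apply: measurable_funTS; exact: continuous_measurable_fun.
- have cI : compact (@I01 R) by exact: segment_compact.
  have cfI : {within @I01 R, continuous f} by exact: continuous_subspaceT.
  have /compact_bounded[M [_ mrt]] := continuous_compact cfI cI.
  by exists M; split; rewrite ?num_real // => ? ? ? ?; exact: mrt.
Qed.

Lemma integral_cst_I01 (s : probability R R) (c : R) : Omega s ->
  (\int[s]_(_ in @I01 R) c%:E)%E = c%:E.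
Proof.
move=> sO; apply: etrans (integral_cst _ measurable_I01 c%:E) _.
exact: etrans (congr1 (mule c%:E) sO) (mule1 _).
Qed.

Definition mean (s : {measure set R -> \bar R}) : R := \int[s]_(x in @I01 R) x.

Definition absdev (s : {measure set R -> \bar R}) (q : R) : R :=
  \int[s]_(x in @I01 R) `|q - x|.

Lemma continuous_dist (q : R) : continuous (fun x : R => `|q - x|).
Proof.
by move=> x; apply: (@cvg_norm _ R); apply: cvgB; [exact: cvg_cst|exact: cvg_id].
Qed.

(** With the other guesses fixed, the payoff is affine in the distance from the bias to one guess;
    this form integrates that guess out. *)
Lemma integral_affine (s : probability R R) (f : R -> R) (b c : R) :
  Omega s -> continuous f ->
  (\int[s]_(x in @I01 R) (b * f x + c)%:E)%E =
    (b * \int[s]_(x in @I01 R) f x + c)%:E.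
Proof.
move=> sO cf; have mI := measurable_I01.
have fI := continuous_integrable_I01 s cf.
under eq_integral do rewrite EFinD EFinM.
rewrite integralD//=; first last.
- exact: finite_measure_integrable_cst.
- exact: integrableZl.
rewrite integralZl// integral_cst_I01//.
by rewrite EFinD EFinM /Rintegral fineK//; exact: integrable_fin_num.
Qed.

Lemma integral_mean (s : probability R R) : Omega s ->
  (\int[s]_(x in @I01 R) x%:E)%E = (mean s)%:E.
Proof.
move=> sO; have := integral_affine 1 0 sO (fun=> cvg_id).
by under eq_integral do rewrite mul1r addr0; rewrite mul1r addr0.
Qed.

(** All guesses lie on one side of the endpoint 0, and likewise of 1, so there Jensen's inequality
    is an equality. *)
Lemma absdev0 (s : probability R R) : absdev s 0 = mean s.
Proof.
apply: eq_Rintegral => x; rewrite inE => /I01P x01.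
by rewrite sub0r normrN ger0_norm//; lra.
Qed.

Lemma Rintegral_affine (s : probability R R) (b c : R) : Omega s ->
  \int[s]_(x in @I01 R) (b * x + c) = b * mean s + c.
Proof.
by move=> sO; rewrite /Rintegral (integral_affine b c sO (fun=> cvg_id)).
Qed.

Lemma absdev1 (s : probability R R) : Omega s -> absdev s 1 = 1 - mean s.
Proof.
move=> sO; transitivity (\int[s]_(x in @I01 R) ((-1) * x + 1)).
  apply: eq_Rintegral => x; rewrite inE => /I01P x01.
  by rewrite ger0_norm; lra.
by rewrite Rintegral_affine//; ring.
Qed.

Lemma absdev_ge (s : probability R R) (q : R) : Omega s ->
  `|q - mean s| <= absdev s q.
Proof.
move=> sO.
have <- : \int[s]_(x in @I01 R) (q - x) = q - mean s.
  rewrite -[RHS](_ : (-1) * mean s + q = _); last by ring.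
  by rewrite -Rintegral_affine//; apply: eq_Rintegral => x _; ring.
apply: le_normr_Rintegral; first exact: measurable_I01.
apply: continuous_integrable_I01 => x.
by apply: cvgB; [exact: cvg_cst|exact: cvg_id].
Qed.

Lemma dirac_I01 (x : R) : I01 x -> (\d_x (@I01 R) = 1 :> \bar R)%E.
Proof. by move=> xI; rewrite diracE mem_set. Qed.

Lemma absdev_dirac (x q : R) : I01 x -> absdev \d_x q = `|q - x|.
Proof.
move=> xI; have mI := measurable_I01.
have mf : measurable_fun (@I01 R) (fun t => `|q - t|%:E).
  apply/measurable_EFinP/measurable_funTS.
  by apply: continuous_measurable_fun; exact: continuous_dist.
rewrite /absdev /Rintegral integral_dirac//.
by rewrite dirac_I01// mul1e.
Qed.

Lemma Omega_dirac (x : R) : I01 x -> Omega (\d_x : probability R R).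
Proof. exact: dirac_I01. Qed.

(** The triangle inequality under the integral; it yields continuity, hence measurability, of the
    averaged payoff. *)
Lemma absdev_lipschitz (s : probability R R) (q r : R) : Omega s ->
  `|absdev s q - absdev s r| <= `|q - r|.
Proof.
move=> sO; have mI := measurable_I01.
have cI t := continuous_integrable_I01 s (@continuous_dist t).
have key u v : absdev s u <= absdev s v + `|u - v|.
  have <- : \int[s]_(x in @I01 R) (`|v - x| + `|u - v|) = absdev s v + `|u - v|.
    rewrite RintegralD//; last exact: finite_measure_integrable_cst.
    by rewrite [in X in _ + X]/Rintegral integral_cst_I01.
  apply: le_Rintegral => //.
    by apply: continuous_integrable_I01 => x; apply: cvgD;
      [exact: continuous_dist|exact: cvg_cst].
  move=> x _ /=; rewrite [leRHS]addrC (_ : u - x = (u - v) + (v - x)).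
    exact: ler_normD.
  by ring.
by rewrite ler_norml; have := key q r; have := key r q; rewrite distrC; lra.
Qed.

(** * The payoff against a fixed bias, averaged over the guesses *)

Definition Fpay (s0 s1 s2 : {measure set R -> \bar R}) (q : R) : R :=
  (1 - q) ^+ 2 * absdev s0 q + 2 * q * (1 - q) * absdev s1 q +
  q ^+ 2 * absdev s2 q.

(** Only the integrand is rewritten, so [nu] may be a bare set function such as [mustar]. *)
Lemma EpayE (s0 s1 s2 : probability R R) (nu : set R -> \bar R) :
  Omega s0 -> Omega s1 -> Omega s2 ->
  Epay s0 s1 s2 nu = (\int[nu]_(q in @I01 R) (Fpay s0 s1 s2 q)%:E)%E.
Proof.
move=> O0 O1 O2; rewrite /Epay; congr integral; apply/funext => q.
have cd := @continuous_dist q.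
rewrite /Fpay.
(* For each guess in turn, the terms of the other two guesses form the constant of
   [integral_affine]. *)
transitivity (\int[s2]_(x2 in @I01 R) (q ^+ 2 * `|q - x2| +
    ((1 - q) ^+ 2 * absdev s0 q + 2 * q * (1 - q) * absdev s1 q))%:E)%E; last first.
  by rewrite integral_affine//; congr EFin; rewrite addrC.
apply: eq_integral => x2 _.
transitivity (\int[s1]_(x1 in @I01 R) ((2 * q * (1 - q)) * `|q - x1| +
    ((1 - q) ^+ 2 * absdev s0 q + q ^+ 2 * `|q - x2|))%:E)%E; last first.
  by rewrite integral_affine//; congr EFin; rewrite -/(absdev s1 q); ring.
apply: eq_integral => x1 _.
transitivity (\int[s0]_(x0 in @I01 R) ((1 - q) ^+ 2 * `|q - x0| +
    (2 * q * (1 - q) * `|q - x1| + q ^+ 2 * `|q - x2|))%:E)%E; last first.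
  by rewrite integral_affine//; congr EFin; rewrite -/(absdev s0 q); ring.
by apply: eq_integral => x0 _; congr EFin; rewrite DpayE; ring.
Qed.

Lemma continuous_absdev (s : probability R R) : Omega s -> continuous (absdev s).
Proof.
move=> sO x; apply/cvgrPdist_le => /= e e0; near=> y.
apply: le_trans (absdev_lipschitz _ _ sO) _.
by near: y; exact: (@cvgr_dist_le _ R _ _ _ id x).
Unshelve. all: by end_near. Qed.

Lemma continuous_Fpay (s0 s1 s2 : probability R R) :
  Omega s0 -> Omega s1 -> Omega s2 -> continuous (Fpay s0 s1 s2).
Proof.
move=> O0 O1 O2 q.
have ca s : Omega s -> absdev s x @[x --> q] --> absdev s q.
  by move=> sO; exact: continuous_absdev.
have ci : (x : R) @[x --> q] --> q by exact: cvg_id.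
have cc (c : R) : c @[x --> q] --> c by exact: cvg_cst.
have c1 : (1 - x : R) @[x --> q] --> 1 - q by exact: cvgB.
apply: cvgD; [apply: cvgD|]; apply: cvgM; try exact: ca.
- by rewrite expr2; under eq_fun do rewrite expr2; exact: cvgM.
- by apply: cvgM => //; exact: cvgM.
- by rewrite expr2; under eq_fun do rewrite expr2; exact: cvgM.
Qed.

Lemma Fpay_ge0 (s0 s1 s2 : probability R R) (q : R) : I01 q ->
  0 <= Fpay s0 s1 s2 q.
Proof.
move=> /I01P /andP[q0 q1].
by rewrite /Fpay !addr_ge0// !mulr_ge0// ?sqr_ge0 ?subr_ge0//;
  apply: Rintegral_ge0.
Qed.

Lemma Fpay_dirac (x0 x1 x2 q : R) : I01 x0 -> I01 x1 -> I01 x2 ->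
  Fpay \d_x0 \d_x1 \d_x2 q = Dpay x0 x1 x2 q.
Proof. by move=> ? ? ?; rewrite DpayE /Fpay !absdev_dirac. Qed.

(** * Finitely supported measures *)

Lemma atomic_measure n (w x : 'I_n -> R) (f : R -> R) :
  (forall i, 0 <= w i) -> (forall i, I01 (x i)) -> continuous f ->
  (forall q, I01 q -> 0 <= f q) ->
  exists m : {measure set R -> \bar R},
    (forall A, m A = (\sum_(i < n) (w i)%:E * \d_(x i) A)%E) /\
    (\int[m]_(q in @I01 R) (f q)%:E)%E = (\sum_(i < n) w i * f (x i))%:E.
Proof.
move=> w0 xI cf f0.
have mI := measurable_I01.
have mf : measurable_fun (@I01 R) (EFin \o f).
  by apply/measurable_EFinP/measurable_funTS; exact: continuous_measurable_fun.
(* [msum] takes a sequence over [nat]; the default [mzero] sits at indices from [n] on, which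
   [msum m n] does not reach. *)
pose m (i : nat) : {measure set R -> \bar R} :=
  match insub i with
  | Some j => mscale (NngNum (w0 j)) \d_(x j)
  | None => mzero
  end.
have f0' q : I01 q -> (0 <= (EFin \o f) q)%E by move=> /f0; rewrite lee_fin.
exists (msum m n); split.
  by move=> A; rewrite /msum; apply: eq_bigr => i _; rewrite /m valK.
rewrite (ge0_integral_measure_sum m mI f0' mf) -sumEFin.
apply: eq_bigr => i _; rewrite /m valK ge0_integral_mscale//.
by rewrite integral_dirac// dirac_I01// mul1e EFinM.
Qed.

(* [mustar] is a bare set function, hence a version of the formula that does
   not refer to a measure structure. *)
Lemma integral_atoms n (w x : 'I_n -> R) (f : R -> R) :
  (forall i, 0 <= w i) -> (forall i, I01 (x i)) -> continuous f ->
  (forall q, I01 q -> 0 <= f q) ->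
  (\int[fun A : set R => (\sum_(i < n) (w i)%:E * \d_(x i) A)%E]_(q in @I01 R)
    (f q)%:E)%E = (\sum_(i < n) w i * f (x i))%:E.
Proof.
move=> w0 xI cf f0; have [m [mE <-]] := atomic_measure w0 xI cf f0.
by congr (integral _); apply/funext => A; rewrite mE.
Qed.

(** For a genuine measure, the values on measurable sets determine the integral; this serves for the
    [nu] of an arbitrary equilibrium. *)
Lemma integral_eq_atoms n (w x : 'I_n -> R) (f : R -> R)
    (nu : {measure set R -> \bar R}) :
  (forall i, 0 <= w i) -> (forall i, I01 (x i)) -> continuous f ->
  (forall q, I01 q -> 0 <= f q) ->
  (forall A, measurable A -> nu A = (\sum_(i < n) (w i)%:E * \d_(x i) A)%E) ->
  (\int[nu]_(q in @I01 R) (f q)%:E)%E = (\sum_(i < n) w i * f (x i))%:E.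
Proof.
move=> w0 xI cf f0 nuE; have [m [mE <-]] := atomic_measure w0 xI cf f0.
by apply: eq_measure_integral => A mA _; rewrite mE nuE.
Qed.

(** Up to a null set, [A] is the union of the atoms it contains, disjoint by injectivity of [x]. *)
Lemma measure_finite_support n (x : 'I_n -> R) (nu : {measure set R -> \bar R})
    (A : set R) :
  injective x -> nu.-negligible (~` range x) -> measurable A ->
  nu A = (\sum_(i < n) nu [set x i] * \d_(x i) A)%E.
Proof.
move=> xinj nux mA.
pose U := \big[setU/set0]_(i < n | x i \in A) [set x i].
have mx i : measurable [set x i] by exact: measurable_set1.
have mU : measurable U by apply: bigsetU_measurable.
have UE y : U y <-> exists2 i, x i \in A & y = x i.
  split=> [|[i xiA ->]]; last by rewrite /U (bigD1 i)//=; left.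
  rewrite /U; elim/big_rec: _ => [//|i B xiA IH [->|/IH//]]; by exists i.
have UA : U `<=` A by move=> y /UE[i /[!inE] xiA ->].
have AU0 : nu (A `\` U) = 0%E.
  apply/negligibleP; first exact: measurableD.
  apply: negligibleS nux => y [Ay nUy] [i _ xiy]; apply: nUy; apply/UE.
  by exists i => //; rewrite inE xiy.
rewrite -(setDUK UA) measureU//; last 2 first.
- exact: measurableD.
- by rewrite setDE setICA setICr setI0.
rewrite [X in (_ + X)%E]AU0 adde0 setDUK// measure_bigsetU_ord//; last first.
  by move=> i j _ _ [y [-> /xinj]].
rewrite big_mkcond; apply: eq_bigr => i _.
by rewrite diracE; case: ifP => _; rewrite ?mule1 ?mule0.
Qed.

End integrals.

(** * The atoms of [mu] and their weights *)

Section equilibrium.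
Context {R : realType}.
Local Notation p := (p1 R).

Lemma big_ord4 (f : 'I_4 -> R) : \sum_i f i =
  f (@Ordinal 4 0 isT) + f (@Ordinal 4 1 isT) + f (@Ordinal 4 2 isT) +
  f (@Ordinal 4 3 isT).
Proof.
rewrite !big_ord_recr big_ord0 /= add0r.
by congr (_ + _ + _ + _); congr f; exact: val_inj.
Qed.

Lemma I01_pp i : I01 (pp R i).
Proof.
apply/I01P; have hp := p1_bounds (R := R).
by case: i => -[|[|[|[|//]]]] ?; rewrite /pp/=; lra.
Qed.

Lemma pp_inj : injective (pp R).
Proof.
have hp := p1_bounds (R := R).
move=> [[|[|[|[|//]]]] ?] [[|[|[|[|//]]]] ?]; rewrite /pp/= => e;
  by [exact: val_inj|exfalso; lra].
Qed.

Lemma mm_gt0 i : 0 < mm R i.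
Proof.
have hm := m1_bounds (R := R).
by case: i => -[|[|[|[|//]]]] ?; rewrite /mm/= /m0; lra.
Qed.

Lemma sum_mm : \sum_i mm R i = 1.
Proof. by rewrite big_ord4 /mm/= /m0; field. Qed.

Lemma I01_a0 : I01 (a0 R).
Proof.
by apply/I01P; have := a0_bounds (R := R); have := p1_bounds (R := R); lra.
Qed.

Lemma I01_a1 : I01 (a1 R).
Proof. by apply/I01P; rewrite /a1; lra. Qed.

Lemma I01_a2 : I01 (a2 R).
Proof. by have /I01P := I01_a0; rewrite /a2 => ?; apply/I01P; lra. Qed.

(** * The lower bound for the payoff against [mu] and its equality case *)

Section payoff_at_atoms.
Variables s0 s1 s2 : probability R R.
Hypotheses (O0 : Omega s0) (O1 : Omega s1) (O2 : Omega s2).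

(* Excess over the lower bound given by Jensen's inequality, with the sign of
   [q - mean s] that is forced when [s] lives on one side of [q]. *)
Let above (s : probability R R) q := absdev s q - (mean s - q).
Let below (s : probability R R) q := absdev s q - (q - mean s).

Let above_ge0 s q : Omega s -> 0 <= above s q.
Proof.
move=> sO; have := absdev_ge q sO; have := ler_norm (mean s - q).
by rewrite distrC /above; lra.
Qed.

Let below_ge0 s q : Omega s -> 0 <= below s q.
Proof.
by move=> sO; have := absdev_ge q sO; have := ler_norm (q - mean s);
  rewrite /below; lra.
Qed.

(** The balance [m0 = m1 * (p ^+ 2 + (1 - p) ^+ 2)] cancels the means of [s0] and [s2], and
    [m1 = m2] cancels that of [s1]; the constants left add up to
    [4 * m1 * p * (1 - p) ^+ 2 = a0]. *)
Lemma sum_mm_Fpay : \sum_i mm R i * Fpay s0 s1 s2 (pp R i) = a0 R +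
  m1 R * ((1 - p) ^+ 2 * below s0 p + p ^+ 2 * below s0 (1 - p) +
          2 * p * (1 - p) * (above s1 p + below s1 (1 - p)) +
          p ^+ 2 * above s2 p + (1 - p) ^+ 2 * above s2 (1 - p)).
Proof.
have a0E : a0 R = 4 * m1 R * p * (1 - p) ^+ 2.
  rewrite /a0 /m1; field; rewrite gt_eqF//.
  by have := sqr_ge0 p; have := sqr_ge0 (1 - p); lra.
have m0E : m0 R = m1 R * (p ^+ 2 + (1 - p) ^+ 2).
  by have := m1_def (R := R); rewrite /m0; lra.
rewrite big_ord4 /mm /pp /= a0E m0E /Fpay !absdev0 !absdev1// /above /below.
by ring.
Qed.

Lemma sum_mm_Fpay_ge : a0 R <= \sum_i mm R i * Fpay s0 s1 s2 (pp R i).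
Proof.
have /andP[p0 p2] := p1_bounds (R := R); have /andP[m0 _] := m1_bounds (R := R).
rewrite sum_mm_Fpay lerDl mulr_ge0 ?(ltW m0)//.
have pq0 : 0 <= 2 * p * (1 - p).
  by have := @mulr_ge0 _ p (1 - p); lra.
apply: addr_ge0; last by apply: mulr_ge0; [exact: sqr_ge0|exact: above_ge0].
apply: addr_ge0; last by apply: mulr_ge0; [exact: sqr_ge0|exact: above_ge0].
apply: addr_ge0; last first.
  by apply: mulr_ge0 => //; apply: addr_ge0; [exact: above_ge0|exact: below_ge0].
by apply: addr_ge0; apply: mulr_ge0; by [exact: sqr_ge0|exact: below_ge0].
Qed.

(** The [mm]-average is at least [a0], so the upper bounds are all equalities and every excess
    vanishes. The means are then read off at the atoms 0, 1 and [p1]. *)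
Lemma mean_of_Fpay_le : (forall i, Fpay s0 s1 s2 (pp R i) <= a0 R) ->
  [/\ mean s0 = a0 R, mean s1 = a1 R & mean s2 = a2 R].
Proof.
move=> Fle.
have /andP[p0 p2] := p1_bounds (R := R); have /andP[m0 _] := m1_bounds (R := R).
have le0 : \sum_i mm R i * (a0 R - Fpay s0 s1 s2 (pp R i)) <= 0.
  under eq_bigr do rewrite mulrBr.
  by rewrite sumrB -mulr_suml sum_mm mul1r subr_le0 sum_mm_Fpay_ge.
have Feq i : Fpay s0 s1 s2 (pp R i) = a0 R.
  have ge0 j : 0 <= mm R j * (a0 R - Fpay s0 s1 s2 (pp R j)).
    by rewrite mulr_ge0 ?subr_ge0// ltW// mm_gt0.
  have /eqP := le_anti (introT andP (conj le0 (sumr_ge0 _ (fun j _ => ge0 j)))).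
  rewrite psumr_eq0// => /allP/(_ i (mem_index_enum _))/=.
  by rewrite mulf_eq0 gt_eqF ?mm_gt0//= subr_eq0 => /eqP.
have := sum_mm_Fpay.
under eq_bigr do rewrite Feq; rewrite -mulr_suml sum_mm mul1r.
have sq0 : 0 < (1 - p) ^+ 2 by rewrite exprn_gt0//; lra.
have p20 : 0 < p ^+ 2 by rewrite exprn_gt0//; lra.
have pq0 : 0 < 2 * p * (1 - p) by have := @mulr_gt0 _ p (1 - p); lra.
set e1 := _ * below s0 p; set e2 := _ * below s0 _; set e3 := _ * (above s1 p + _).
set e4 := _ * above s2 p; set e5 := _ * above s2 _ => /eqP.
(* Cancelling [a0] and dividing by [m1 > 0] leaves a vanishing sum of nonnegative excess terms. *)
rewrite -[eqbLHS]addr0 (inj_eq (addrI _)) eq_sym mulf_eq0 gt_eqF//= => /eqP e.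
have e1_0 : 0 <= e1 by rewrite mulr_ge0 ?below_ge0// ltW.
have e2_0 : 0 <= e2 by rewrite mulr_ge0 ?below_ge0// ltW.
have e3_0 : 0 <= e3.
  apply: mulr_ge0; first exact: ltW.
  by apply: addr_ge0; [exact: above_ge0|exact: below_ge0].
have e4_0 : 0 <= e4 by rewrite mulr_ge0 ?above_ge0// ltW.
have e5_0 : 0 <= e5 by rewrite mulr_ge0 ?above_ge0// ltW.
have b0 : below s0 p = 0.
  by apply: (mulfI (lt0r_neq0 sq0)); rewrite mulr0 -/e1; lra.
have c0 : above s1 p + below s1 (1 - p) = 0.
  by apply: (mulfI (lt0r_neq0 pq0)); rewrite mulr0 -/e3; lra.
have d0 : above s2 p = 0.
  by apply: (mulfI (lt0r_neq0 p20)); rewrite mulr0 -/e4; lra.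
have {c0} c0 : above s1 p = 0.
  by have := above_ge0 p O1; have := below_ge0 (1 - p) O1; lra.
(* At bias 0 only the guess after no heads counts, at bias 1 only the guess after two heads. *)
have F0 : mean s0 = a0 R.
  by have := Feq (@Ordinal 4 0 isT); rewrite /Fpay /pp/= !absdev0; lra.
have F3 : mean s2 = a2 R.
  have := Feq (@Ordinal 4 3 isT).
  by rewrite /Fpay /pp/= !absdev1// /a2; lra.
split=> //.
(* At [p1] the payoffs of [s] and of the pure guesses agree; the outer terms coincide, so the middle
   ones do. *)
have := Feq (@Ordinal 4 1 isT); rewrite -[in RHS](Dpay_pp (@Ordinal 4 1 isT)).
rewrite DpayE /Fpay /pp/=.
have -> : absdev s0 p = p - a0 R by move: b0; rewrite /below F0; lra.
have -> : absdev s2 p = a2 R - p by move: d0; rewrite /above F3; lra.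
have -> : absdev s1 p = mean s1 - p by move: c0; rewrite /above; lra.
have ha := a0_bounds (R := R).
rewrite (ger0_norm (_ : 0 <= p - a0 R)); last lra.
rewrite (ler0_norm (_ : p - a1 R <= 0)); last by rewrite /a1; lra.
rewrite (ler0_norm (_ : p - a2 R <= 0)); last by rewrite /a2; lra.
by rewrite !opprB => /addIr/addrI/(mulfI (lt0r_neq0 pq0))/addIr.
Qed.

End payoff_at_atoms.

(** * First-order conditions on the weights of an optimal [nu] *)

Lemma sum_Dpay_pp (n : 'I_4 -> R) (x0 x1 x2 : R) :
  0 <= x0 <= p -> p <= x1 <= 1 - p -> 1 - p <= x2 <= 1 ->
  \sum_i n i * Dpay x0 x1 x2 (pp R i) =
    n (@Ordinal 4 0 isT) * x0 +
    n (@Ordinal 4 1 isT) * ((1 - p) ^+ 2 * (p - x0) +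
       2 * p * (1 - p) * (x1 - p) + p ^+ 2 * (x2 - p)) +
    n (@Ordinal 4 2 isT) * (p ^+ 2 * (1 - p - x0) +
       2 * p * (1 - p) * (1 - p - x1) + (1 - p) ^+ 2 * (x2 - (1 - p))) +
    n (@Ordinal 4 3 isT) * (1 - x2).
Proof.
move=> h0 h1 h2; have hp := p1_bounds (R := R).
(* Each guess stays between two neighbouring atoms, so every distance has a fixed sign. *)
rewrite big_ord4 /pp/= !DpayE.
rewrite (ler0_norm (_ : 0 - x0 <= 0)); last lra.
rewrite (ger0_norm (_ : 0 <= p - x0)); last lra.
rewrite (ler0_norm (_ : p - x1 <= 0)); last lra.
rewrite (ler0_norm (_ : p - x2 <= 0)); last lra.
rewrite (ger0_norm (_ : 0 <= 1 - p - x0)); last lra.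
rewrite (ger0_norm (_ : 0 <= 1 - p - x1)); last lra.
rewrite (ler0_norm (_ : 1 - p - x2 <= 0)); last lra.
rewrite (ger0_norm (_ : 0 <= 1 - x2)); last lra.
by ring.
Qed.

Lemma affine_ge0 (k u v : R) : u < 0 -> 0 < v -> 0 <= k * u -> 0 <= k * v -> k = 0.
Proof.
move=> u0 v0 ku kv; apply: le_anti.
by rewrite -(nmulr_lge0 _ u0) ku -(pmulr_lge0 _ v0) kv.
Qed.

(* The payoff is affine in each guess near [(a0, a1, a2)], so optimality of this
   interior point makes the three slopes vanish; with total mass 1 this is a
   nonsingular linear system for the weights. *)
Lemma weights_uniq (n : 'I_4 -> R) : \sum_i n i = 1 ->
  (forall x0 x1 x2 : R, I01 x0 -> I01 x1 -> I01 x2 ->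
    a0 R <= \sum_i n i * Dpay x0 x1 x2 (pp R i)) ->
  n =1 mm R.
Proof.
move=> n1 nmin.
have hp := p1_bounds (R := R); have ha := a0_bounds (R := R).
have opt : \sum_i n i * Dpay (a0 R) (a1 R) (a2 R) (pp R i) = a0 R.
  by under eq_bigr do rewrite Dpay_pp; rewrite -mulr_suml n1 mul1r.
have key x0 x1 x2 : 0 <= x0 <= p -> p <= x1 <= 1 - p -> 1 - p <= x2 <= 1 ->
    \sum_i n i * Dpay (a0 R) (a1 R) (a2 R) (pp R i) <=
    \sum_i n i * Dpay x0 x1 x2 (pp R i).
  by move=> h0 h1 h2; rewrite opt; apply: nmin; apply/I01P; lra.
have b0 : 0 <= a0 R <= p by lra.
have b1 : p <= a1 R <= 1 - p by rewrite /a1; lra.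
have b2 : 1 - p <= a2 R <= 1 by rewrite /a2; lra.
move: n1; rewrite big_ord4.
set n0 := n _; set n1 := n _; set n2 := n _; set n3 := n _ => nsum.
have keyE x0 x1 x2 : 0 <= x0 <= p -> p <= x1 <= 1 - p -> 1 - p <= x2 <= 1 ->
    0 <= (n0 - n1 * (1 - p) ^+ 2 - n2 * p ^+ 2) * (x0 - a0 R) +
         2 * p * (1 - p) * (n1 - n2) * (x1 - a1 R) +
         (n1 * p ^+ 2 + n2 * (1 - p) ^+ 2 - n3) * (x2 - a2 R).
  move=> h0 h1 h2; have := key _ _ _ h0 h1 h2.
  by rewrite !sum_Dpay_pp// -/n0 -/n1 -/n2 -/n3 -subr_ge0; congr (0 <= _); ring.
(* One guess at a time is moved to both ends of its interval, the other two staying put. *)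
have k0 : n0 - n1 * (1 - p) ^+ 2 - n2 * p ^+ 2 = 0.
  apply: (@affine_ge0 _ (0 - a0 R) (p - a0 R)); [lra|lra| |].
  - have z0 : 0 <= (0 : R) <= p by lra.
    by have := keyE _ _ _ z0 b1 b2; rewrite !subrr !mulr0 !addr0.
  - have z0 : 0 <= p <= p by lra.
    by have := keyE _ _ _ z0 b1 b2; rewrite !subrr !mulr0 !addr0.
have k1 : 2 * p * (1 - p) * (n1 - n2) = 0.
  apply: (@affine_ge0 _ (p - a1 R) (1 - p - a1 R)); [rewrite /a1; lra..| |].
  - have z1 : p <= p <= 1 - p by lra.
    by have := keyE _ _ _ b0 z1 b2; rewrite !subrr !mulr0 addr0 add0r.
  - have z1 : p <= 1 - p <= 1 - p by lra.
    by have := keyE _ _ _ b0 z1 b2; rewrite !subrr !mulr0 addr0 add0r.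
have k2 : n1 * p ^+ 2 + n2 * (1 - p) ^+ 2 - n3 = 0.
  apply: (@affine_ge0 _ (1 - p - a2 R) (1 - a2 R)); [rewrite /a2; lra..| |].
  - have z2 : 1 - p <= 1 - p <= 1 by lra.
    by have := keyE _ _ _ b0 b1 z2; rewrite !subrr !mulr0 !add0r.
  - have z2 : 1 - p <= 1 <= (1 : R) by lra.
    by have := keyE _ _ _ b0 b1 z2; rewrite !subrr !mulr0 !add0r.
have n12 : n1 = n2.
  apply/eqP; rewrite -subr_eq0; move/eqP: k1; rewrite mulf_eq0 gt_eqF//=.
  by have := @mulr_gt0 _ p (1 - p); lra.
rewrite -n12 in k0 k2 nsum.
have sq_gt0 : 0 < p ^+ 2 + (1 - p) ^+ 2 + 1.
  by have := sqr_ge0 p; have := sqr_ge0 (1 - p); lra.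
(* Both outer weights equal [n1 * (p ^+ 2 + (1 - p) ^+ 2)], so total mass 1 gives the equation of
   [m1_def]. *)
have n1E : n1 = m1 R.
  apply: (mulIf (lt0r_neq0 sq_gt0)); rewrite m1_def; lra.
have n0E : n0 = m0 R by rewrite /m0 -n1E; lra.
have n3E : n3 = m0 R by rewrite /m0 -n1E; lra.
by case=> -[|[|[|[|//]]]] i; rewrite /mm/= -?n1E -?n0E //;
  [congr n|congr n|rewrite n12; congr n|rewrite n0E -n3E; congr n]; exact: val_inj.
Qed.

(** * Payoffs against [mu], point masses and general biases *)

Lemma Epay_mustar (s0 s1 s2 : probability R R) :
  Omega s0 -> Omega s1 -> Omega s2 ->
  Epay s0 s1 s2 (@mustar R) = (\sum_i mm R i * Fpay s0 s1 s2 (pp R i))%:E.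
Proof.
move=> O0 O1 O2; rewrite EpayE//; apply: integral_atoms.
- by move=> i; exact/ltW/mm_gt0.
- exact: I01_pp.
- exact: continuous_Fpay.
- by move=> q; exact: Fpay_ge0.
Qed.

Lemma Epay_dirac (s0 s1 s2 : probability R R) (q : R) :
  Omega s0 -> Omega s1 -> Omega s2 -> I01 q ->
  Epay s0 s1 s2 \d_q = (Fpay s0 s1 s2 q)%:E.
Proof.
move=> O0 O1 O2 qI; rewrite EpayE// integral_dirac.
- by rewrite dirac_I01// mul1e.
- exact: measurable_I01.
- apply/measurable_EFinP/measurable_funTS.
  by apply: continuous_measurable_fun; exact: continuous_Fpay.
Qed.

Lemma Epay_guess_le (nu : probability R R) : Omega nu ->
  (Epay \d_(a0 R) \d_(a1 R) \d_(a2 R) nu <= (a0 R)%:E)%E.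
Proof.
move=> nuO.
have O0 := Omega_dirac I01_a0; have O1 := Omega_dirac I01_a1.
have O2 := Omega_dirac I01_a2.
rewrite (EpayE nu O0 O1 O2) -(integral_cst_I01 (a0 R) nuO).
apply: ge0_le_integral => //.
- exact: measurable_I01.
- by move=> q qI; rewrite lee_fin; exact: Fpay_ge0.
- apply/measurable_EFinP/measurable_funTS.
  by apply: continuous_measurable_fun; exact: continuous_Fpay.
- move=> q /I01P qI; rewrite lee_fin (Fpay_dirac _ I01_a0 I01_a1 I01_a2).
  exact: Dpay_le.
Qed.

(* Equality in [Dpay_le] only holds at the atoms. *)
Lemma support_of_Epay_eq (nu : probability R R) : Omega nu ->
  Epay \d_(a0 R) \d_(a1 R) \d_(a2 R) nu = (a0 R)%:E ->
  nu.-negligible (~` range (pp R)).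
Proof.
move=> nuO nuE.
have O0 := Omega_dirac I01_a0; have O1 := Omega_dirac I01_a1.
have O2 := Omega_dirac I01_a2; have mI := @measurable_I01 R.
set F := Fpay \d_(a0 R) \d_(a1 R) \d_(a2 R).
have FE q : F q = Dpay (a0 R) (a1 R) (a2 R) q.
  by apply: Fpay_dirac; [exact: I01_a0|exact: I01_a1|exact: I01_a2].
have cF : continuous F by exact: continuous_Fpay.
have cG : continuous (fun q => (-1) * F q + a0 R).
  move=> q; apply: cvgD; last exact: cvg_cst.
  by apply: cvgM; [exact: cvg_cst|exact: cF].
(* The gap [a0 - F] is nonnegative on [0,1] with zero integral, so it vanishes almost everywhere
   there. *)
have G0 : (\int[nu]_(q in @I01 R) ((-1) * F q + a0 R)%:E)%E = 0%E.
  have := integral_affine (-1) (a0 R) nuO cF; rewrite /Rintegral.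
  rewrite -(EpayE nu O0 O1 O2) nuE /= => ->; congr EFin; ring.
have : (\int[nu]_(q in @I01 R) `|((-1) * F q + a0 R)%:E|)%E = 0%E.
  rewrite -[RHS]G0; apply: eq_integral => q /[!inE] /I01P qI.
  by rewrite /= ger0_norm// FE; have := Dpay_le qI; lra.
have mG : measurable_fun (@I01 R) (fun q => ((-1) * F q + a0 R)%:E).
  by apply/measurable_EFinP/measurable_funTS; exact: continuous_measurable_fun.
move/(ae_eq_integral_abs nu mI mG) => /= neg.
have negC : nu.-negligible (~` @I01 R).
  apply/negligibleP; first exact: measurableC.
  apply: etrans (probability_setC nu mI) _.
  by apply: etrans (congr1 (fun z => 1 - z)%E nuO) _; rewrite subee.
apply: negligibleS (negligibleU neg negC) => q qn.
have [qI|] := pselect (I01 q); last by right.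
left => /= /(_ qI) [] e; apply: qn.
have [i ->] : exists i, q = pp R i; last by exists i.
by apply: Dpay_eq; [exact/I01P|rewrite -FE; lra].
Qed.

End equilibrium.

(** * The saddle point property and uniqueness *)

Theorem theorem5p1 (R : realType) :
  (* p1 is the unique real root of x^3 - x^2 + 3x - 1 *)
  (p1 R ^+ 3 - p1 R ^+ 2 + 3 * p1 R - 1 = 0 /\
   forall x : R, x ^+ 3 - x ^+ 2 + 3 * x - 1 = 0 -> x = p1 R) /\
  (* (delta_a0, delta_a1, delta_a2; mu) is a Nash equilibrium *)
  saddle \d_(a0 R) \d_(a1 R) \d_(a2 R) (@mustar R) /\
  (* uniqueness *)
  (forall s0 s1 s2 nu : probability R R,
     Omega s0 -> Omega s1 -> Omega s2 -> Omega nu ->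
     saddle s0 s1 s2 nu ->
     ((\int[s0]_(x in @I01 R) x%:E)%E = (a0 R)%:E /\
      (\int[s1]_(x in @I01 R) x%:E)%E = (a1 R)%:E /\
      (\int[s2]_(x in @I01 R) x%:E)%E = (a2 R)%:E) /\
     (forall A : set R, measurable A -> nu A = mustar A)).
Proof.
have A0 := Omega_dirac (@I01_a0 R); have A1 := Omega_dirac (@I01_a1 R).
have A2 := Omega_dirac (@I01_a2 R).
split; first by split; [exact: p1_root|exact: p1_root_uniq].
split.
  move=> t0 t1 t2 nu T0 T1 T2 nuO.
  have -> : Epay (\d_(a0 R) : probability R R) (\d_(a1 R) : probability R R)
      (\d_(a2 R) : probability R R) (@mustar R) = (a0 R)%:E.
    rewrite Epay_mustar//; congr EFin.
    under eq_bigr => i _ do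
      rewrite (Fpay_dirac _ (@I01_a0 R) (@I01_a1 R) (@I01_a2 R)) Dpay_pp.
    by rewrite -mulr_suml sum_mm mul1r.
  split; first exact: Epay_guess_le.
  by rewrite Epay_mustar// lee_fin; exact: sum_mm_Fpay_ge.
move=> s0 s1 s2 nu S0 S1 S2 nuO sad.
have FleE q : I01 q -> ((Fpay s0 s1 s2 q)%:E <= Epay s0 s1 s2 nu)%E.
  move=> qI; rewrite -Epay_dirac//.
  by have [] := sad _ _ _ _ A0 A1 A2 (Omega_dirac qI).
have Ele t0 t1 t2 : Omega t0 -> Omega t1 -> Omega t2 ->
    (Epay s0 s1 s2 nu <= Epay t0 t1 t2 nu)%E.
  by move=> T0 T1 T2; have [] := sad _ _ _ _ T0 T1 T2 nuO.
have EleA := Ele _ _ _ A0 A1 A2.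
have Ele0 := le_trans EleA (Epay_guess_le nuO).
have Fle i : Fpay s0 s1 s2 (pp R i) <= a0 R.
  by rewrite -lee_fin (le_trans (FleE _ (I01_pp i))).
have [M0 M1 M2] := mean_of_Fpay_le S0 S1 S2 Fle.
rewrite !integral_mean// M0 M1 M2; split=> //.
(* The lower bound tests the bias 0, where the payoff is [mean s0 = a0]. *)
have EE : Epay s0 s1 s2 nu = (a0 R)%:E.
  apply/le_anti; rewrite Ele0/= (le_trans _ (FleE _ (I01_pp ord0)))//.
  by rewrite lee_fin /Fpay /pp/= absdev0 M0; lra.
have neg : nu.-negligible (~` range (pp R)).
  apply: support_of_Epay_eq => //; apply/le_anti.
  by rewrite Epay_guess_le//= -EE.
have nu_fin i : nu [set pp R i] \is a fin_num by exact: fin_num_measure.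
pose n i := fine (nu [set pp R i]).
have nuE A : measurable A -> nu A = (\sum_(i < 4) (n i)%:E * \d_(pp R i) A)%E.
  move=> mA; rewrite (measure_finite_support (@pp_inj R) neg mA).
  by apply: eq_bigr => i _; rewrite fineK.
suff nm : n =1 mm R.
  by move=> A mA; rewrite nuE// /mustar; apply: eq_bigr => i _; rewrite nm.
apply: weights_uniq.
  (* Evaluating [nu] on [0,1], which contains all atoms, gives total weight 1. *)
  have := nuE _ (@measurable_I01 R).
  rewrite (eq_bigr (fun i => (n i)%:E)); last first.
    by move=> i _; rewrite dirac_I01 ?mule1//; exact: I01_pp.
  by rewrite sumEFin [X in X = _ -> _]nuO => -[].
move=> x0 x1 x2 X0 X1 X2.
rewrite -lee_fin -EE; apply: le_trans (Ele _ _ _ (Omega_dirac X0)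
  (Omega_dirac X1) (Omega_dirac X2)) _.
rewrite (EpayE nu (Omega_dirac X0) (Omega_dirac X1) (Omega_dirac X2)).
rewrite (@integral_eq_atoms _ _ n (pp R))//.
- by rewrite lee_fin; apply: ler_sum => i _; rewrite Fpay_dirac.
- by move=> i; exact: fine_ge0.
- exact: I01_pp.
- by apply: continuous_Fpay; exact: Omega_dirac.
- by move=> q qI; exact: Fpay_ge0.
Qed.
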